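(* Let $i\neq j$ be two rectangular objects with parameters $\mathrm{LB}_{ks},\mathrm{UB}_{ks},\mathrm{P}_{kls}$ ($(k,l,s)\in\mathscr{F}_{ij}$) as described in the context. If $\mathrm{P}_{kls}<\mathrm{UB}_{ls}-\mathrm{LB}_{ks}$ for each $(k,l,s)\in\mathscr{F}_{ij}$, then the Refined Unary formulation (RU) is pairwise-ideal; that is, every extreme point $(\mathbf{c},\boldsymbol\delta)\in\mathbb{R}^4\times\mathbb{R}^4$ of the continuous relaxation of (RU) for the pair $(i,j)$ satisfies $\boldsymbol\delta\in\{0,1\}^4$.
   Context: Parameters. The region has dimensions $W_x\times W_y$. Each object $k\in\{i,j\}$ has dimensions $w_{ks}>0$ and clearances $\sigma^-_{ks},\sigma^+_{ks}\ge 0$ for $s\in\{x,y\}$. Put $\mathscr{F}_{ij}=\{(i,j,x),(j,i,x),(i,j,y),(j,i,y)\}$, $\mathrm{LB}_{ks}=\tfrac12 w_{ks}+\sigma^-_{ks}$ and $\mathrm{UB}_{ks}=W_s-\tfrac12 w_{ks}-\sigma^+_{ks}$. The precedence margins $\mathrm{P}_{kls}$, $(k,l,s)\in\mathscr{F}_{ij}$, are reals with $\mathrm{P}_{kls}\ge\tfrac12 w_{ks}+\tfrac12 w_{ls}+\max\{\sigma^+_{ks},\sigma^-_{ls}\}$ (equality in the basic model; larger margins are allowed). Formulation (RU) for the pair $(i,j)$. Continuous variables $c_{ix},c_{jx},c_{iy},c_{jy}$ and binary variables $\delta_{ijx},\delta_{jix},\delta_{ijy},\delta_{jiy}$, with constraints,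 for all $(k,l,s)\in\mathscr{F}_{ij}$: $$c_{ls}\ge \mathrm{LB}_{ls}+(\mathrm{LB}_{ks}+\mathrm{P}_{kls}-\mathrm{LB}_{ls})\delta_{kls},$$ $$c_{ks}\le \mathrm{UB}_{ks}+(\mathrm{UB}_{ls}-\mathrm{P}_{kls}-\mathrm{UB}_{ks})\delta_{kls},$$ $$c_{ks}-c_{ls}\le \mathrm{P}_{lks}-(\mathrm{P}_{lks}+\mathrm{P}_{kls})\delta_{kls}+(\mathrm{UB}_{ks}-\mathrm{P}_{lks}-\mathrm{LB}_{ls})\delta_{lks},$$ $$\delta_{kls}\in\{0,1\},$$ together with $\delta_{ijs}+\delta_{jis}\le1$ for $s\in\{x,y\}$ and $\delta_{ijx}+\delta_{jix}+\delta_{ijy}+\delta_{jiy}\ge1$. The continuous relaxation replaces $\delta_{kls}\in\{0,1\}$ by $0\le\delta_{kls}\le1$. A mixed-integer program is ideal if every extreme point of its continuous relaxation takes integer values in all integer variables; a packing formulation is pairwise-ideal if it is ideal when restricted to two objects. *)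

(* Defs.v *)
From HB Require Import structures.
From mathcomp Require Import all_boot all_order all_algebra.

Set Implicit Arguments.
Unset Strict Implicit.
Unset Printing Implicit Defensive.

Import Order.TTheory GRing.Theory Num.Theory.
Local Open Scope ring_scope.

Definition extreme_point (R : numDomainType) (V : lmodType R)
    (S : V -> Prop) (p : V) : Prop :=
  S p /\ forall (a b : V) (t : R), S a -> S b -> 0 < t < 1 ->
    p = t *: a + (1 - t) *: b -> a = p /\ b = p.

(* A mixed 0-1 program with continuous variables indexed by C and binary
   variables indexed by B is given by its constraints other than the
   integrality requirements on the binary variables; its objective function is
   irrelevant to idealness. The coefficients are taken in R^o so that points
   carry the R-module structure of R^C x R^B. *)
Definition point (R : numDomainType) (C B : finType) : lmodType R :=
  ({ffun C -> R^o} * {ffun B -> R^o})%type.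

Definition mbp (R : numDomainType) (C B : finType) : Type :=
  point R C B -> Prop.

Definition relaxation (R : numDomainType) (C B : finType) (M : mbp R C B) :
    mbp R C B :=
  fun p => M p /\ forall b, 0 <= p.2 b <= 1.

Definition binary (R : numDomainType) (B : finType) (delta : B -> R) : Prop :=
  forall b, delta b = 0 \/ delta b = 1.

Definition feasible (R : numDomainType) (C B : finType) (M : mbp R C B) :
    mbp R C B :=
  fun p => M p /\ binary p.2.

Definition ideal (R : numDomainType) (C B : finType) (M : mbp R C B) : Prop :=
  forall p : point R C B, extreme_point (relaxation M) p -> binary p.2.

Variant object := Oi | Oj.
Variant axis := Ax | Ay.

Definition bool_of_object (k : object) : bool := if k is Oi then true else false.
Definition object_of_bool (b : bool) : object := if b then Oi else Oj.
Lemma bool_of_objectK : cancel bool_of_object object_of_bool.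
Proof. by case. Qed.
HB.instance Definition _ := Finite.copy object (can_type bool_of_objectK).

Definition bool_of_axis (s : axis) : bool := if s is Ax then true else false.
Definition axis_of_bool (b : bool) : axis := if b then Ax else Ay.
Lemma bool_of_axisK : cancel bool_of_axis axis_of_bool.
Proof. by case. Qed.
HB.instance Definition _ := Finite.copy axis (can_type bool_of_axisK).

Definition other (k : object) : object := if k is Oi then Oj else Oi.

(* With only two objects, the triple (k, l, s) with k != l (object k precedes
   object l along axis s) is determined by (k, s), since l = other k; so
   [(k, s) : precedence] stands for (k, other k, s), and its reverse (l, k, s)
   is (other k, s). *)
Definition precedence : finType := (object * axis)%type.

(* [clearm k s] and [clearp k s] are the clearances of object k below and
   above it along axis s; [pmargin] is the family of precedence margins. *)
Record packing_data (R : realFieldType) := PackingData {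
  region : axis -> R;
  width : object -> axis -> R;
  clearm : object -> axis -> R;
  clearp : object -> axis -> R;
  pmargin : precedence -> R
}.

Definition LB (R : realFieldType) (d : packing_data R)
    (k : object) (s : axis) : R :=
  width d k s / 2 + clearm d k s.

Definition UB (R : realFieldType) (d : packing_data R)
    (k : object) (s : axis) : R :=
  region d s - width d k s / 2 - clearp d k s.

Definition valid_data (R : realFieldType) (d : packing_data R) : Prop :=
  (forall k s, 0 < width d k s /\ 0 <= clearm d k s /\ 0 <= clearp d k s) /\
  (forall k s, let l := other k in
     width d k s / 2 + width d l s / 2
       + Num.max (clearp d k s) (clearm d l s) <= pmargin d (k, s)).

Definition RU (R : realFieldType) (d : packing_data R) :
    mbp R (object * axis)%type precedence := fun p =>
  let c k s : R := p.1 (k, s) in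
  let delta k s : R := p.2 (k, s) in
  [/\ forall k s, let l := other k in
        LB d l s + (LB d k s + pmargin d (k, s) - LB d l s) * delta k s <= c l s,
      forall k s, let l := other k in
        c k s <= UB d k s + (UB d l s - pmargin d (k, s) - UB d k s) * delta k s,
      forall k s, let l := other k in
        c k s - c l s <= pmargin d (l, s)
                         - (pmargin d (l, s) + pmargin d (k, s)) * delta k s
                         + (UB d k s - pmargin d (l, s) - LB d l s) * delta l s,
      forall s, delta Oi s + delta Oj s <= 1
    & 1 <= delta Oi Ax + delta Oj Ax + delta Oi Ay + delta Oj Ay].

(* Main.v *)
(* On one axis, the constraints of RU for fixed (delta_ij, delta_ji) say that
   (c_i, c_j) lies in a planar polygon with edge normals +-e_i, +-e_j,
   +-(e_i - e_j). Its right-hand sides are the combination, with weights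
   1 - delta_ij - delta_ji, delta_ij and delta_ji, of the right-hand sides of
   the polygons Z0, Zij, Zji obtained at the three integral values of delta.
   The hypotheses on the margins make every right-hand side of these polygons
   tight, and for tight polygons with these normals the Minkowski sum is
   obtained by adding right-hand sides. So c is a weighted sum of points of Z0,
   Zij and Zji; keeping these points fixed and moving the weights lifts any
   move of delta affinely to the relaxation. Hence delta is extreme among the
   vectors satisfying the pure delta constraints, and these form an integral
   polytope. *)
Require Import Defs.
From mathcomp Require Import all_boot all_order all_algebra.
From mathcomp Require Import ring lra.
Import Order.TTheory GRing.Theory Num.Theory.
Local Open Scope ring_scope.

Set Implicit Arguments.
Unset Strict Implicit.

(** [p] is the midpoint of [p + v] and [p - v], so extremality makes both equal to [p]. *)
Lemma extreme_point_perturb (R : realFieldType) (V : lmodType R)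
    (S : V -> Prop) (p v : V) :
  extreme_point S p -> S (p + v) -> S (p - v) -> v = 0.
Proof.
move=> [_ ext] Sp Sm.
have half1 : 1 - 2^-1 = 2^-1 :> R by lra.
have [||+ _] := ext _ _ 2^-1 Sp Sm.
- by rewrite invr_gt0 ltr0n invf_lt1 ?ltr0n // ltr1n.
- rewrite half1 -scalerDr addrACA subrr addr0 -mulr2n -scaler_nat scalerA.
  by rewrite mulVf ?scale1r // pnatr_eq0.
by move/(congr1 (fun x => x - p)); rewrite addrAC subrr add0r.
Qed.

(** * Planar zones *)

Record zone (R : realFieldType) := Zone {
  lower : object -> R;
  upper : object -> R;
  gap : object -> R
}.

Section Zones.
Variable R : realFieldType.
Implicit Types (A B : zone R) (z : object -> R).

Definition in_zone A z : Prop := forall k,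
  [/\ lower A k <= z k, z k <= upper A k & z k - z (other k) <= gap A k].

(* These inequalities hold exactly when each of the six constraints of the zone
   is attained at some point of it. *)
Definition tight A : Prop := forall k, let l := other k in
  lower A k <= upper A k /\ 0 <= gap A k + gap A l /\
  [/\ gap A k <= upper A k - lower A l,
      lower A l - gap A l <= lower A k
    & upper A k <= upper A l + gap A k].

Definition zone_add A B := Zone
  (fun k => lower A k + lower B k)
  (fun k => upper A k + upper B k)
  (fun k => gap A k + gap B k).

Definition zone_scale (a : R) A := Zone
  (fun k => a * lower A k) (fun k => a * upper A k)
  (fun k => a * gap A k).

(** These are difference constraints between [z Oi], [z Oj] and the constant 0; the hypotheses
    exclude cycles of negative total weight. *)
Lemma zone_inhabited A :
  (forall k, let l := other k in
     [/\ lower A k <= upper A k, 0 <= gap A k + gap A l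
       & lower A k - upper A l <= gap A k]) ->
  exists z, in_zone A z.
Proof.
move=> hA; have /= [i1 i2 i3] := hA Oi; have /= [j1 j2 j3] := hA Oj.
(* [x] is the least first coordinate allowed by the lower bounds and [gap A Oj]; [y] is the least
   second coordinate allowed once [x] is chosen. *)
pose x := Num.max (lower A Oi) (lower A Oj - gap A Oj).
pose y := Num.max (lower A Oj) (x - gap A Oi).
have [x1 x2] : lower A Oi <= x /\ lower A Oj - gap A Oj <= x.
  by rewrite !le_max !lexx orbT.
have x3 : x <= upper A Oi by rewrite ge_max; apply/andP; split; lra.
have x4 : x <= upper A Oj + gap A Oi.
  by rewrite ge_max; apply/andP; split; lra.
have [y1 y2] : lower A Oj <= y /\ x - gap A Oi <= y.
  by rewrite !le_max !lexx orbT.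
have y3 : y <= upper A Oj by rewrite ge_max; apply/andP; split; lra.
have y4 : y <= x + gap A Oj by rewrite ge_max; apply/andP; split; lra.
exists (fun k => if k is Oi then x else y).
by case; split => /=; lra.
Qed.

Lemma tight_inhabited A : tight A -> exists z, in_zone A z.
Proof.
move=> tA; have := tA Oi; have := tA Oj => /=.
move=> [? [? [? ? ?]]] [? [? [? ? ?]]].
by apply: zone_inhabited; case; split => /=; lra.
Qed.

Lemma tight_add A B : tight A -> tight B -> tight (zone_add A B).
Proof.
move=> tA tB k /=.
have [? [? [? ? ?]]] := tA k; have [? [? [? ? ?]]] := tB k.
by do 3?split; lra.
Qed.

Lemma tight_scale (a : R) A : 0 <= a -> tight A -> tight (zone_scale a A).
Proof.
move=> a0 tA k /=; have [? [? [? ? ?]]] := tA k.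
rewrite -!mulrDr -!mulrBr; do 3?split; rewrite ?ler_wpM2l ?mulr_ge0 //.
Qed.

Lemma in_zone_add A B z1 z2 : in_zone A z1 -> in_zone B z2 ->
  in_zone (zone_add A B) (fun k => z1 k + z2 k).
Proof.
by move=> h1 h2 k; case: (h1 k) => ? ? ?; case: (h2 k); split => /=; lra.
Qed.

Lemma in_zone_scale (a : R) A z : 0 <= a -> in_zone A z ->
  in_zone (zone_scale a A) (fun k => a * z k).
Proof. by move=> a0 h k; case: (h k); split; rewrite /= -?mulrBr ler_wpM2l. Qed.

Lemma in_zone_addP A B z : tight A -> tight B -> in_zone (zone_add A B) z ->
  exists z1 z2, [/\ in_zone A z1, in_zone B z2 & forall k, z k = z1 k + z2 k].
Proof.
move=> tA tB hz.
(* [C] is the intersection of [A] with the reflected zone of all [z - w], [w] in [B]; tightness of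
   [A] and [B] makes it nonempty. *)
pose C := Zone
  (fun k => Num.max (lower A k) (z k - upper B k))
  (fun k => Num.min (upper A k) (z k - lower B k))
  (fun k => Num.min (gap A k) (z k - z (other k) + gap B (other k))).
have otherK k : other (other k) = k by case: k.
have [z1 hz1] : exists z1, in_zone C z1.
  apply: zone_inhabited => k /=; rewrite otherK.
  have /= [? [? [? ? ?]]] := tA k; have /= [? [? [? ? ?]]] := tB k.
  have := tA (other k); have := tB (other k); rewrite /= otherK.
  move=> [? [? [? ? ?]]] [? [? [? ? ?]]].
  have := hz k; have := hz (other k); rewrite /= otherK => -[? ? ?] [? ? ?].
  split.
  - by rewrite ge_max !le_min; lra.
  - by rewrite addr_minl !addr_minr !le_min; lra.
  - by rewrite !le_min !lerBlDr !ge_max !addr_minr !le_min; lra.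
exists z1, (fun k => z k - z1 k); split=> k; last by rewrite addrC subrK.
- by have [] := hz1 k; rewrite /= ge_max !le_min => /andP[? ?] /andP[? ?] /andP[].
have [] := hz1 (other k); have [] := hz1 k; rewrite /= otherK !ge_max !le_min.
move=> /andP[? ?] /andP[? ?] /andP[? ?] /andP[? ?] /andP[? ?] /andP[? ?].
by split; lra.
Qed.

Lemma in_zone_scaleP (a : R) A z : 0 <= a -> tight A ->
  in_zone (zone_scale a A) z ->
  exists2 z', in_zone A z' & forall k, z k = a * z' k.
Proof.
rewrite le_eqVlt => /predU1P[<- tA hz|a0 tA hz].
  (* For [a = 0] the point [z] vanishes and any point of [A] serves; tightness supplies one. *)
  have [z' hz'] := tight_inhabited tA; exists z' => // k.
  by have [] := hz k; rewrite /= !mul0r => *; lra.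
exists (fun k => a^-1 * z k) => k; last by rewrite mulVKf ?gt_eqF.
have [h1 h2 h3] := hz k.
by split; rewrite -?mulrBr -(ler_pM2l a0) mulVKf ?gt_eqF.
Qed.

End Zones.

(** * The polytope of the binary variables *)

(** The upper bounds [delta b <= 1] follow from the first two conditions. *)
Definition pure_binary_polytope (R : realFieldType)
    (delta : {ffun precedence -> R^o}) : Prop :=
  [/\ forall b, 0 <= delta b,
      forall s, delta (Oi, s) + delta (Oj, s) <= 1 :> R
    & 1 <= delta (Oi, Ax) + delta (Oj, Ax) + delta (Oi, Ay) + delta (Oj, Ay)
      :> R].

Definition other_axis (s : axis) : axis := if s is Ax then Ay else Ax.

(** The polytope is invariant under exchanging the axes and, on each axis separately, the objects.
    So an argument may single out any entry [(k, s)] and any [m] on the other axis. *)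
Lemma pure_binary_polytopeE (R : realFieldType)
    (delta : {ffun precedence -> R^o}) k s m : let t := other_axis s in
  pure_binary_polytope delta <->
  [/\ [/\ 0 <= delta (k, s), 0 <= delta (other k, s),
          0 <= delta (m, t) & 0 <= delta (other m, t)],
      delta (k, s) + delta (other k, s) <= 1 :> R,
      delta (m, t) + delta (other m, t) <= 1 :> R
    & 1 <= delta (k, s) + delta (other k, s)
           + (delta (m, t) + delta (other m, t)) :> R].
Proof.
have pairC (f : object -> R) n : f n + f (other n) = f Oi + f Oj.
  by case: n; rewrite // addrC.
rewrite /= (pairC (fun n => delta (n, s))).
rewrite (pairC (fun n => delta (n, other_axis s))).
split=> [[h0 h1 h2]|[[h1 h2 h3 h4] h5 h6 h7]].
  by split=> //; case: s => /=; [rewrite addrA|rewrite addrC addrA].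
split.
- move=> [n u].
  by case: s u k m n h1 h2 h3 h4 {h5 h6 h7} => [] [] [] [] [].
- by case; case: s h5 h6 {h1 h2 h3 h4 h7}.
- move: h7; case: s {h1 h2 h3 h4 h5 h6} => /=; first by rewrite addrA.
  by rewrite addrC addrA.
Qed.

(** Turns extremality into scalar inequalities for moves of at most three entries, within reach of
    linear arithmetic. *)
Lemma pure_binary_polytope_rigid (R : realFieldType)
    (delta : {ffun precedence -> R^o}) k s m (e e' f : R) :
    let t := other_axis s in
    let feasible a b c d := [/\ [/\ 0 <= a, 0 <= b, 0 <= c & 0 <= d],
                              a + b <= 1, c + d <= 1 & 1 <= a + b + (c + d)] in
    let a := delta (k, s) : R in let b := delta (other k, s) : R in
    let c := delta (m, t) : R in let d := delta (other m, t) : R in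
  extreme_point (@pure_binary_polytope R) delta ->
  feasible (a + e) (b + e') (c + f) d -> feasible (a - e) (b - e') (c - f) d ->
  e = 0.
Proof.
move=> t feasible a b c d ext hp hm.
pose v : {ffun precedence -> R^o} := [ffun q : precedence =>
  (if q == (k, s) then e else if q == (other k, s) then e'
   else if q == (m, t) then f else 0) : R^o].
have [v1 v2 v3 v4] : [/\ v (k, s) = e, v (other k, s) = e', v (m, t) = f
                       & v (other m, t) = 0].
  by rewrite !ffunE /t; split; case: (k); case: (m); case: (s).
have addE (w1 w2 : {ffun precedence -> R^o}) q : (w1 + w2) q = w1 q + w2 q :> R.
  by rewrite ffunE.
have oppE (w : {ffun precedence -> R^o}) q : (- w) q = - w q :> R.
  by rewrite ffunE.
rewrite -v1 (extreme_point_perturb (v := v) ext) ?ffunE //.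
  by apply/(pure_binary_polytopeE _ k s m); rewrite !addE v1 v2 v3 v4 addr0.
by apply/(pure_binary_polytopeE _ k s m); rewrite !addE !oppE v1 v2 v3 v4 subr0.
Qed.

(* Two positive entries on the same axis can be moved in opposite directions.
   Otherwise each axis has a single positive entry, and a fractional one can be
   moved alone if the entry on the other axis is 1, and against that entry if
   it is fractional too. *)
Lemma pure_binary_polytope_integral (R : realFieldType)
    (delta : {ffun precedence -> R^o}) :
  extreme_point (@pure_binary_polytope R) delta -> binary delta.
Proof.
move=> ext; have deltaT := ext.1; have [T0 _ _] := deltaT.
have below2 (x y : R) : 0 < x -> 0 < y -> exists e, [/\ 0 < e, e <= x & e <= y].
  move=> x0 y0; exists (Num.min x y).
  by rewrite lt_min x0 y0 !ge_min !lexx orbT.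
have sep k s : 0 < delta (k, s) :> R -> delta (other k, s) = 0 :> R.
  move=> ks; have [[_ k's t1 t2] T1 T2 T3] :=
    (pure_binary_polytopeE delta k s Oi).1 deltaT.
  apply/eqP; case: eqP => // /eqP; rewrite neq_lt ltNge k's /= => {}k's.
  have [e [e0 ek el]] := below2 _ _ ks k's.
  suff e_eq0 : e = 0 by rewrite e_eq0 ltxx in e0.
  apply: (pure_binary_polytope_rigid (k := k) (s := s) (m := Oi) (e' := - e)
    (f := 0) ext); do 2?split; lra.
move=> [k s].
have /predU1P[<-|ks] : (0 == delta (k, s) :> R) || (0 < delta (k, s) :> R).
- by rewrite -le_eqVlt; exact: T0.
- by left.
right; apply/eqP; case: eqP => // /eqP ks1; exfalso.
have k's := sep _ _ ks; set t := other_axis s.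
have [[_ _ i0 j0] T1 T2 T3] := (pure_binary_polytopeE delta k s Oi).1 deltaT.
have {}ks1 : 0 < 1 - delta (k, s) :> R.
  by rewrite subr_gt0 lt_neqAle ks1 /=; lra.
(* The entries on axis [s] sum to less than 1, so the covering constraint forces a positive entry on
   axis [t]. *)
have [m mt] : exists m, 0 < delta (m, t) :> R.
  have [it|it] := ltP 0 (delta (Oi, t) : R); first by exists Oi.
  by exists Oj; rewrite /= -/t in i0 j0 T1 T2 T3 *; lra.
have m't := sep _ _ mt.
have [e [e0 ea e1]] := below2 _ _ ks ks1.
have [{i0 j0 T1 T2 T3}[_ _ c0 d0] T1 T2 T3] :=
  (pure_binary_polytopeE delta k s m).1 deltaT.
rewrite -/t in c0 d0 T2 T3.
have [mt1|mt1] := eqVneq (delta (m, t) : R) 1.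
  suff e_eq0 : e = 0 by rewrite e_eq0 ltxx in e0.
  apply: (pure_binary_polytope_rigid (k := k) (s := s) (m := m) (e' := 0)
    (f := 0) ext); rewrite -/t; do 2?split; lra.
have {}mt1 : 0 < 1 - delta (m, t) :> R.
  by rewrite subr_gt0 lt_neqAle mt1 /=; lra.
have [f [f0 fa f1]] := below2 _ _ mt mt1.
have [g [g0 ge gf]] := below2 _ _ e0 f0.
suff g_eq0 : g = 0 by rewrite g_eq0 ltxx in g0.
apply: (pure_binary_polytope_rigid (k := k) (s := s) (m := m) (e' := 0)
  (f := - g) ext); rewrite -/t; do 2?split; lra.
Qed.

(** * The formulation in terms of zones *)

Section RefinedUnary.
Variables (R : realFieldType) (d : packing_data R).
Hypothesis d_valid : valid_data d.
Hypothesis P_lt : forall (k : object) (s : axis),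
  pmargin d (k, s) < UB d (other k) s - LB d k s.

Definition free_zone (s : axis) := Zone
  (LB d ^~ s) (UB d ^~ s) (fun k => pmargin d (other k, s)).

(** The polygon for value 1 at [(k, s)] and 0 at its reverse: Zij for [Oi], Zji for [Oj];
    [free_zone s] is Z0. *)
Definition order_zone (s : axis) (k : object) := let l := other k in Zone
  (fun m => if m == k then LB d k s else LB d k s + pmargin d (k, s))
  (fun m => if m == k then UB d l s - pmargin d (k, s) else UB d l s)
  (fun m => if m == k then - pmargin d (k, s) else UB d l s - LB d k s).

(** The first three bounds hold because the margin dominates the half widths plus either clearance;
    the last comes from [P_lt]. They yield the tightness of all three polygons. *)
Lemma margin_bounds k s : let l := other k in
  [/\ 0 <= pmargin d (k, s),
      LB d l s <= LB d k s + pmargin d (k, s),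
      UB d l s <= UB d k s + pmargin d (k, s)
    & pmargin d (k, s) <= UB d l s - LB d k s].
Proof.
move=> l; have [dpos /(_ k s) /= P_ge] := d_valid.
have [wk [? ?]] := dpos k s; have [wl [? ?]] := dpos l s.
have /andP[? ?] : (clearp d k s <= Num.max (clearp d k s) (clearm d l s)) &&
    (clearm d l s <= Num.max (clearp d k s) (clearm d l s)).
  by rewrite !le_max !lexx orbT.
split; rewrite ?(ltW (P_lt k s)) // /LB /UB; rewrite -/l in P_ge; lra.
Qed.

Lemma tight_free_zone s : tight (free_zone s).
Proof.
have /= [? ? ? ?] := margin_bounds Oi s; have /= [? ? ? ?] := margin_bounds Oj s.
by case; do 3?split => /=; lra.
Qed.

Lemma tight_order_zone s k : tight (order_zone s k).
Proof.
have /= [? ? ? ?] := margin_bounds Oi s; have /= [? ? ? ?] := margin_bounds Oj s.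
by case: k; case; do 3?split => /=; lra.
Qed.

Definition mixed_zone (s : axis) (delta : object -> R) : zone R :=
  zone_add (zone_scale (1 - delta Oi - delta Oj) (free_zone s))
    (zone_add (zone_scale (delta Oi) (order_zone s Oi))
              (zone_scale (delta Oj) (order_zone s Oj))).

(** Each right-hand side is affine in the two binary variables of its axis, hence is the weighted
    combination of its values at (0,0), (1,0) and (0,1). *)
Lemma relaxation_RU (p : point R (object * axis)%type precedence) :
  relaxation (RU d) p <->
  pure_binary_polytope p.2 /\
  forall s, in_zone (mixed_zone s (fun k => p.2 (k, s))) (fun k => p.1 (k, s)).
Proof.
split=> [[[h1 h2 h3 h4 h5] h6]|[[h1 h4 h5] h]].
  split; first by split=> // b; have /andP[] := h6 b.
  move=> s; move: (h1 Oi s) (h1 Oj s) (h2 Oi s) (h2 Oj s) (h3 Oi s) (h3 Oj s).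
  by rewrite /= => *; case; split => /=; lra.
split; last first.
  move=> [k s]; rewrite h1 /=; have := h4 s.
  by have := h1 (Oi, s); have := h1 (Oj, s); case: k => *; lra.
by split=> // k s; have /= [? ? ?] := h s Oi; have /= [? ? ?] := h s Oj;
  case: k => /=; lra.
Qed.

(** Two Minkowski splittings separate the three summands, then each weight is divided out. *)
Lemma mixed_zoneP s (delta : object -> R) z :
  (forall k, 0 <= delta k) -> delta Oi + delta Oj <= 1 ->
  in_zone (mixed_zone s delta) z ->
  exists z0 zi zj, [/\ in_zone (free_zone s) z0,
    in_zone (order_zone s Oi) zi, in_zone (order_zone s Oj) zj &
    forall k, z k = (1 - delta Oi - delta Oj) * z0 k +
                    (delta Oi * zi k + delta Oj * zj k)].
Proof.
move=> d0 d1; have w0 : 0 <= 1 - delta Oi - delta Oj by lra.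
have t0 := tight_scale w0 (tight_free_zone s).
have ti := tight_scale (d0 Oi) (tight_order_zone s Oi).
have tj := tight_scale (d0 Oj) (tight_order_zone s Oj).
case/(in_zone_addP t0 (tight_add ti tj)) => y0 [yij [h0 hij e]].
have [yi [yj [hi hj e']]] := in_zone_addP ti tj hij.
have [z0 hz0 e0] := in_zone_scaleP w0 (tight_free_zone s) h0.
have [zi hzi ei] := in_zone_scaleP (d0 Oi) (tight_order_zone s Oi) hi.
have [zj hzj ej] := in_zone_scaleP (d0 Oj) (tight_order_zone s Oj) hj.
by exists z0, zi, zj; split=> // k; rewrite e e' e0 ei ej.
Qed.

Lemma extreme_point_pure_binary (p : point R (object * axis)%type precedence) :
  extreme_point (relaxation (RU d)) p ->
  extreme_point (@pure_binary_polytope R) p.2.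
Proof.
case=> /relaxation_RU[pT pz] ext; split=> // a b t aT bT t01 pE.
have [T0 T1 _] := pT.
have dec s := mixed_zoneP (fun k => T0 (k, s)) (T1 s) (pz s).
have [x0 [xi [xj [hx0 hxi hxj ex]]]] := dec Ax.
have [y0 [yi [yj [hy0 hyi hyj ey]]]] := dec Ay.
(* [lift] is affine in [e], since the six polygon points found for [p] stay fixed and only their
   weights vary. *)
pose lift (e : {ffun precedence -> R^o}) :
    point R (object * axis)%type precedence :=
  ([ffun q => (1 - e (Oi, q.2) - e (Oj, q.2)) *
        (if q.2 is Ax then x0 q.1 else y0 q.1) +
      (e (Oi, q.2) * (if q.2 is Ax then xi q.1 else yi q.1) +
       e (Oj, q.2) * (if q.2 is Ax then xj q.1 else yj q.1)) : R^o], e).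
have liftP e : pure_binary_polytope e -> relaxation (RU d) (lift e).
  move=> eT; apply/relaxation_RU; split=> // s; have [e0 /(_ s) e1 _] := eT.
  have w0 : 0 <= 1 - e (Oi, s) - e (Oj, s) :> R by lra.
  have step z0 zi zj : in_zone (free_zone s) z0 ->
      in_zone (order_zone s Oi) zi -> in_zone (order_zone s Oj) zj ->
      in_zone (mixed_zone s (fun k => e (k, s)))
        (fun k => (1 - e (Oi, s) - e (Oj, s)) * z0 k +
                  (e (Oi, s) * zi k + e (Oj, s) * zj k)).
    by move=> *; do !apply: in_zone_add; exact: in_zone_scale.
  case: s {e1} w0 step => w0 step k.
    by have := step _ _ _ hx0 hxi hxj k; rewrite !ffunE.
  by have := step _ _ _ hy0 hyi hyj k; rewrite !ffunE.
have lift_p : lift p.2 = p.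
  rewrite [RHS]surjective_pairing; congr pair; apply/ffunP => -[k []].
    by rewrite ffunE ex.
  by rewrite ffunE ey.
have pab : p = t *: lift a + (1 - t) *: lift b.
  rewrite -[LHS]lift_p {1}pE; congr pair; apply/ffunP => q.
  rewrite !ffunE /GRing.scale /=; ring.
have [la lb] := ext _ _ _ (liftP _ aT) (liftP _ bT) t01 pab.
by split; [rewrite -la | rewrite -lb].
Qed.

End RefinedUnary.

Unset Implicit Arguments.

Theorem theorem2 (R : realFieldType) (d : packing_data R)
  (d_valid : valid_data d)
  (P_lt : forall (k : object) (s : axis),
      pmargin d (k, s) < UB d (other k) s - LB d k s) :
  ideal (RU d).
Proof.
move=> p /(extreme_point_pure_binary d_valid P_lt).
exact: pure_binary_polytope_integral.
Qed.
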